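(* For any graph $G$ on $n$ vertices, \[ L_{\circ}(G) \geq \frac{1}{2}\log \iota(G) - 8\log^*\! n. \]
   Context: All graphs are finite and simple. For nonempty $X \subseteq V(G)$, $\alpha(X)$ is the independence number of the subgraph induced by $X$, and $\iota(G) := \sup_{\emptyset\neq X \subseteq V(G)} |X|/\alpha(X)$. $C_\circ(G)$ is the set of integers $t$ such that $G$ contains a cycle of odd length $t$, and $L_\circ(G) := \sum_{t \in C_\circ(G)} 1/t$. $\log$ is the natural logarithm, and $\log^*\! n$ is the number of times the natural logarithm must be applied to $n$ to get a number less than one. *)

(* Defs.v *)
From mathcomp Require Import all_boot all_order all_algebra.
From mathcomp Require Import all_classical all_reals all_analysis.

Set Implicit Arguments.
Unset Strict Implicit.
Unset Printing Implicit Defensive.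

Import Order.TTheory GRing.Theory Num.Theory.

Local Open Scope ring_scope.

Definition simple_graph (G : finType) (edge : rel G) : Prop :=
  symmetric edge /\ irreflexive edge.

Definition independent (G : finType) (edge : rel G) (S : {set G}) : bool :=
  [forall x in S, forall y in S, ~~ edge x y].

Definition alpha (G : finType) (edge : rel G) (X : {set G}) : nat :=
  (\max_(S : {set G} | (S \subset X) && independent edge S) #|S|)%N.

(* [ucycle] alone also accepts the empty sequence and single edges traversed
   back and forth; hence the explicit lower bound on the length. *)
Definition has_cycle (G : finType) (edge : rel G) (t : nat) : bool :=
  (2 < t)%N && [exists c : t.-tuple G, ucycleb edge c].

Definition odd_cycle_length (G : finType) (edge : rel G) (t : nat) : bool :=
  odd t && has_cycle edge t.

(* Justifies the finite range of the sum in [odd_cycle_sum]. *)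
Lemma odd_cycle_length_le (G : finType) (edge : rel G) t :
  odd_cycle_length edge t -> (t <= #|G|)%N.
Proof.
case/and3P=> _ _ /existsP[c /andP[_ /card_uniqP cE]].
by rewrite -(size_tuple c) -cE max_card.
Qed.

(* For the graph with no vertices this is the supremum of the empty set,
   which the library sets to 0. *)
Definition hall_ratio (R : realType) (G : finType) (edge : rel G) : R :=
  reals.sup (fun r : R => exists2 X : {set G},
    X != finset.set0 & r = #|X|%:R / (alpha edge X)%:R).

Definition odd_cycle_sum (R : realType) (G : finType) (edge : rel G) : R :=
  \sum_(0 <= t < #|G|.+1 | odd_cycle_length edge t) t%:R^-1.

(* The library's [ln] is 0 on nonpositive reals, but starting from a natural
   number it is only ever applied to a value >= 1 before the iteration below
   first drops under 1. *)
Lemma iter_ln_lt1 (R : realType) (n : nat) : exists k, iter k (@ln R) n%:R < 1.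
Proof.
have H k : (exists j, iter j (@ln R) n%:R < 1)
    \/ iter k (@ln R) n%:R <= n%:R - k%:R.
  elim: k => [|k [IH|IH]]; [by right; rewrite subr0|by left|].
  have [h|h] := ltP (iter k (@ln R) n%:R) 1; first by left; exists k.
  right; rewrite iterS; set x := iter k _ _ in IH h *.
  have := @le_ln1Dx R (x - 1).
  rewrite [1 + _]addrC subrK => /(_ _)/le_trans; apply.
    by rewrite ltrBrDr addNr (lt_le_trans ltr01).
  by rewrite -natr1 opprD addrA lerB.
have [//|h] := H n.
by exists n; rewrite (le_lt_trans h) // subrr.
Qed.

Definition log_star (R : realType) (n : nat) : nat :=
  ex_minn (iter_ln_lt1 R n).

(* Main.v *)
(* Idea. Let X have Hall ratio k = |X| / alpha(X). Growing balls in X until one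
   grows by a factor of at most K, and throwing away the boundary of each, some
   ball of radius r <= log |X| / log K has ratio at least k / K; taking every
   other breadth-first layer, some layer has ratio at least k / 2K. Inside a
   subset of that layer of maximal ratio, every set of at most m vertices
   expands provided that it has ratio at most k / 8K, so Posa rotations give a
   cycle of length at least 4m with a chord. Closing bichromatic paths of that
   cycle through the breadth-first tree gives cycles of all odd lengths in
   (2r, 2m].
   If |X| <= k^4, then K = 4 and K = sqrt k, with m = k / 8K, together give all
   odd lengths from a constant to k / 16. In general take K = 4 and
   m = k log |X|: either all sets of size at most m have small ratio, giving all
   odd lengths from about 2 log |X| to 2k log |X|, or one passes to a set Y of
   ratio k / 32 with |Y| <= k log |X|. Then either |Y| is polynomial in k, or
   |Y| <= (log x)^2 when |X| <= x^2, and one iterates with log x in place of x.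
   Each iteration costs a constant and there are at most log* n of them. *)
Require Import Defs.
From mathcomp Require Import all_boot all_order all_algebra.
From mathcomp Require Import zify ring lra boolp.

Set Implicit Arguments.
Unset Strict Implicit.
Unset Printing Implicit Defensive.

Import Order.TTheory GRing.Theory Num.Theory.

Local Open Scope ring_scope.

(** * Bichromatic paths in a cycle with a chord *)

Lemma periodicMz (T : Type) (c : int -> T) (m x z : int) :
  (forall x, c (x + m) = c x) -> c (x + m * z) = c x.
Proof.
move=> c_per.
have pos n y : c (y + m * n%:Z) = c y.
  elim: n y => [|n IH] y; first by rewrite mulr0 addr0.
  by rewrite -[in RHS]IH -[in RHS]c_per; congr c; lia.
case: (intP z) => [|n|n]; first by rewrite mulr0 addr0.
  exact: pos.
by rewrite -(pos n.+1 (x + _)); congr c; lia.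
Qed.

(** The start [a] of the window is left free: one symmetry below is tested on a window starting at
    0, the other on one ending at [l]. *)
Lemma eq_periodic (T : Type) (c d : int -> T) (m a : int) : 0 < m ->
  (forall x, c (x + m) = c x) -> (forall x, d (x + m) = d x) ->
  (forall x, a <= x < a + m -> c x = d x) -> forall x, c x = d x.
Proof.
move=> m_gt0 c_per d_per cd x.
rewrite -(periodicMz x (- ((x - a) %/ m)%Z) c_per).
rewrite -(periodicMz x (- ((x - a) %/ m)%Z) d_per).
by apply: cd; have := divz_eq (x - a) m; have := modz_ge0 (x - a) (lt0r_neq0 m_gt0);
  have := ltz_pmod (x - a) m_gt0; lia.
Qed.

Section BichromaticPath.
Variables (V : finType) (e : rel V).
Hypothesis e_sym : symmetric e.
(* A cycle of length N with a chord: the vertices in cyclic order, indexed by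
   the integers modulo N, the chord joining g 0 and g p. *)
Variables (g : int -> V) (N p : int).
Hypothesis g_per : forall x, g (x + N) = g x.
Hypothesis g_inj : forall x y, `|x - y| < N -> g x = g y -> x = y.
Hypothesis g_edge : forall x, e (g x) (g (x + 1)).
Hypothesis p_range : 1 < p < N - 1.
Hypothesis g_chord : e (g 0) (g p).
Variable col : V -> bool.

Definition bichromatic_path (l : nat) := exists (x : V) (q : seq V),
  [/\ path e x q, uniq (x :: q), size q = l, col x != col (last x q) &
      forall y, y \in x :: q -> exists i, y = g i].

(* The path runs along s1 from g (s1 a) to g (s1 0), then jumps to g (s2 0). *)
Lemma two_arms (s1 s2 : int -> int) (a b : nat) :
  (forall i, e (g (s1 i)) (g (s1 (i + 1)))) ->
  (forall i, e (g (s2 i)) (g (s2 (i + 1)))) ->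
  e (g (s1 0)) (g (s2 0)) ->
  (forall i j : nat, (i <= a)%N -> (j <= a)%N -> g (s1 i) = g (s1 j) -> i = j) ->
  (forall i j : nat, (i <= b)%N -> (j <= b)%N -> g (s2 i) = g (s2 j) -> i = j) ->
  (forall i j : nat, (i <= a)%N -> (j <= b)%N -> g (s1 i) <> g (s2 j)) ->
  ~ bichromatic_path (a + b).+1 -> col (g (s1 a)) = col (g (s2 b)).
Proof.
move=> e1 e2 e12 u1 u2 u12 nbi.
pose f1 (i : nat) := g (s1 i); pose f2 (i : nat) := g (s2 i).
pose S := rev (mkseq f1 a.+1) ++ mkseq f2 b.+1.
have sS : size S = (a + b).+2 by rewrite size_cat size_rev !size_mkseq addnS.
have nthS d i : (i < (a + b).+2)%N ->
    nth d S i = if (i <= a)%N then f1 (a - i)%N else f2 (i - a.+1)%N.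
  move=> ilt; rewrite nth_cat size_rev size_mkseq ltnS.
  case: leqP => ia; last by rewrite nth_mkseq //; lia.
  by rewrite nth_rev size_mkseq // nth_mkseq ?subSS //; lia.
have uS : uniq S.
  rewrite cat_uniq rev_uniq.
  apply/and3P; split.
  - by apply/mkseq_uniqP => i j; rewrite !inE !ltnS; apply: u1.
  - apply/hasPn => y /mapP[j]; rewrite mem_iota /= add0n ltnS => jb ->.
    rewrite mem_rev; apply/mapP => -[i]; rewrite mem_iota add0n ltnS => ia.
    by move/esym; apply: u12.
  - by apply/mkseq_uniqP => i j; rewrite !inE !ltnS; apply: u2.
have := sS; case ES: S => [//|x q] sxq.
apply/eqP; apply: contraT => ncol; case: nbi; exists x, q; split.
- apply/(pathP x) => i; have := sxq.
  case=> sq iq; rewrite -[nth x q i]/(nth x (x :: q) i.+1) -ES !nthS; try lia.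
  case: (ltngtP i a) => ia.
  + rewrite e_sym /f1; set k := (a - i.+1)%N.
    by have -> : ((a - i)%N : int) = k%:Z + 1 by lia.
  + rewrite /f2; set k := (i - a.+1)%N.
    by have -> : ((i.+1 - a.+1)%N : int) = k%:Z + 1 by lia.
  + by rewrite ia /f1 /f2 !subnn.
- by rewrite -ES.
- by case: sxq.
- have xE : x = f1 a by rewrite -[x]/(nth x (x :: q) 0) -ES nthS // subn0.
  have -> : last x q = f2 b.
    case: sxq => sq; rewrite (last_nth x) sq -ES nthS //.
    by rewrite ifF; [congr f2; lia | lia].
  by rewrite xE.
- move=> y; rewrite -ES mem_cat mem_rev => /orP[] /mapP[i _ ->].
    by exists (s1 i).
  by exists (s2 i).
Qed.

(* Without a bichromatic path of length l, the colouring c of the integers has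
   periods N and l; paths through the chord add the period p + 1 and the
   symmetries x <-> -x and x <-> p - 1 - x, hence the period 2. As l is odd, c
   is constant. *)
Lemma bichromatic_path_of_long_arc (l : nat) : odd l -> l%:Z <= p ->
  (exists x, col (g x) <> col (g 0)) -> bichromatic_path l.
Proof.
move=> l_odd lp [x0 ncol].
apply: contrapT => nbi; apply: ncol.
pose c x := col (g x).
have l_gt0 : (0 < l)%N by case: (l) l_odd.
have gE x y : `|x - y| < N -> g x = g y -> x = y := @g_inj x y.
have eP x y : y = x + 1 -> e (g x) (g y) by move=> ->.
have eN x y : y = x - 1 -> e (g x) (g y).
  by move=> ->; rewrite e_sym; apply: eP; lia.
(* An arc of the cycle itself, with the single vertex [g x] as its first arm. *)
have cl x : c (x + l%:Z) = c x.
  rewrite /c; symmetry.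
  have := @two_arms (fun i => x - i) (fun i => x + 1 + i) 0 l.-1.
  rewrite add0n prednK // => /(_ _ _ _ _ _ _ nbi).
  have -> : x + 1 + l.-1 = x + l by lia.
  rewrite subr0; apply.
  - by move=> i; apply: eN; lia.
  - by move=> i; apply: eP; lia.
  - by apply: eP; lia.
  - by move=> i j; rewrite !leqn0 => /eqP-> /eqP->.
  - by move=> i j il jl /gE; lia.
  - by move=> i j il jl /gE; lia.
have cN x : c (x + N) = c x by rewrite /c g_per.
(* The path goes from [g j] down to [g 0], over the chord, then down from [g p] for [l - 1 - j]
   steps. Its arms are disjoint because [l <= p], and its far end is [j + (p + 1)] modulo [l]. *)
have per_p x : c (x + (p + 1)) = c x.
  symmetry; apply: (@eq_periodic _ _ (fun x => c (x + (p + 1))) l 0) => //.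
  - by move=> y; rewrite -[RHS]cl; congr c; lia.
  move=> y; rewrite add0r => /andP[y0 yl] {x}.
  have [j jE] : exists j : nat, y = j by exists `|y|%N; lia.
  subst y.
  have -> : c (j%:Z + (p + 1)) = c (p - (l.-1 - j)%N%:Z).
    by rewrite -[RHS]cl; congr c; lia.
  have := @two_arms (fun i => i) (fun i => p - i) j (l.-1 - j)%N.
  have -> : (j + (l.-1 - j)).+1%N = l by lia.
  move=> /(_ _ _ _ _ _ _ nbi); apply => //.
  - by move=> i; apply: eN; lia.
  - by rewrite subr0.
  - by move=> i i' il jl /gE; lia.
  - by move=> i i' il jl /gE; lia.
  - by move=> i i' il jl /gE; lia.
(* The arc outside [[0, p]] has [w] interior vertices, so an arm entering it may make at most [w]
   steps. Both [l] and [w] are periods, so testing the symmetries on a window of length [m <= w] is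
   enough and keeps the arms disjoint. *)
pose w := N - p - 1.
have w_gt0 : 0 < w by lia.
have per_w x : c (x + w) = c x by rewrite -per_p -[RHS]cN; congr c; lia.
pose m := Num.min l%:Z w.
have m_gt0 : 0 < m by lia.
have per_m x : c (x + m) = c x by rewrite /m; case: leP.
have c_opp x : c x = c (- x).
  apply: (@eq_periodic _ _ (fun x => c (- x)) m 0) => //.
    by move=> y; rewrite -(per_m (- _)); congr c; lia.
  move=> y; rewrite add0r => /andP[y0 ym] {x}.
  have [j jE] : exists j : nat, y = j by exists `|y|%N; lia.
  subst y.
  rewrite -per_p.
  have -> : c (j%:Z + (p + 1)) = c (p - (l.-1 - j)%N%:Z).
    by rewrite -[RHS]cl; congr c; lia.
  symmetry.
  have := @two_arms (fun i => - i) (fun i => p - i) j (l.-1 - j)%N.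
  have -> : (j + (l.-1 - j)).+1%N = l by lia.
  move=> /(_ _ _ _ _ _ _ nbi); apply => //.
  - by move=> i; apply: eN; lia.
  - by move=> i; apply: eN; lia.
  - by rewrite subr0 oppr0.
  - by move=> i i' il jl /gE; lia.
  - by move=> i i' il jl /gE; lia.
  - by move=> i i' il jl /gE; lia.
have c_refl x : c x = c (p - 1 - x).
  apply: (@eq_periodic _ _ (fun x => c (p - 1 - x)) m (l%:Z - m)) => //.
    by move=> y; rewrite -(per_m (_ - (_ + _))); congr c; lia.
  move=> y; rewrite subrK => /andP[y0 ym] {x}.
  have [j jE] : exists j : nat, y = j by exists `|y|%N; lia.
  subst y.
  have -> : c (p - 1 - j%:Z) = c (p + (l.-1 - j)%N%:Z).
    by rewrite -cl; congr c; lia.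
  have := @two_arms (fun i => i) (fun i => p + i) j (l.-1 - j)%N.
  have -> : (j + (l.-1 - j)).+1%N = l by lia.
  move=> /(_ _ _ _ _ _ _ nbi); apply => //.
  - by move=> i; apply: eP; lia.
  - by rewrite addr0.
  - by move=> i i' il jl /gE; lia.
  - by move=> i i' il jl /gE; lia.
  - by move=> i i' il jl /gE; lia.
have per2 x : c (x + 2) = c x.
  by rewrite [RHS]c_refl c_opp -per_p; congr c; lia.
have per1 x : c (x + 1) = c x.
  rewrite -[RHS]cl -(periodicMz (x + 1) (l./2)%:Z per2); congr c.
  by have := odd_double_half l; rewrite l_odd; lia.
by rewrite -[x0](mul1r) -[1 * x0]add0r; apply: (periodicMz 0 x0 per1).
Qed.
End BichromaticPath.

(** The chord cuts the cycle into arcs of lengths [p] and [N - p], and the longer one has length at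
    least [l]. If it is the second, the orientation is reversed. *)
Lemma bichromatic_path_theta (V : finType) (e : rel V) (g : int -> V)
    (N p : int) (col : V -> bool) (l : nat) : symmetric e ->
  (forall x, g (x + N) = g x) ->
  (forall x y, `|x - y| < N -> g x = g y -> x = y) ->
  (forall x, e (g x) (g (x + 1))) -> 1 < p < N - 1 -> e (g 0) (g p) ->
  odd l -> l%:Z * 2 <= N -> (exists x, col (g x) <> col (g 0)) ->
  bichromatic_path e g col l.
Proof.
move=> e_sym g_per g_inj g_edge p_range chord l_odd lN ncol.
have [lp|lp] := leP l%:Z p.
  exact: (@bichromatic_path_of_long_arc V e e_sym g N p).
have gE x y : x = y -> g x = g y by move=> ->.
have [|||||||x [q [? ? ? ? img]]] := @bichromatic_path_of_long_arc V e e_sym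
    (fun x => g (- x)) N (N - p) _ _ _ _ _ col l l_odd.
- by move=> x; rewrite -(g_per (- (x + N))); apply: gE; lia.
- by move=> x y xy /g_inj; lia.
- move=> x; rewrite e_sym; have := g_edge (- (x + 1)).
  by congr (e _ (g _)); lia.
- lia.
- by rewrite -(g_per (- (N - p))) oppr0; move: chord; congr (e _ (g _)); lia.
- lia.
- by case: ncol => x ncol; exists (- x); rewrite opprK oppr0.
- exists x, q; split=> // y /img[i ->]; by exists (- i).
Qed.

(** * Closing paths through a tree *)

Section TreeCycles.
Variables (V : finType) (e : rel V).
Hypotheses (e_sym : symmetric e).
Variables (Y : {set V}) (root : V) (dep : V -> nat) (par : V -> V).
Hypothesis dep0 : forall y, y \in Y -> dep y = 0%N -> y = root.
Hypothesis parP : forall y j, y \in Y -> dep y = j.+1 ->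
  [/\ par y \in Y, dep (par y) = j & e (par y) y].

Lemma iter_parP y i k : y \in Y -> dep y = i -> (k <= i)%N ->
  iter k par y \in Y /\ dep (iter k par y) = (i - k)%N.
Proof.
move=> yY dy; elim: k => [|k IH] ki; first by rewrite subn0.
have [kY dk] := IH (ltnW ki).
have [|pY dp _] := parP kY (j := (i - k.+1)%N); first by rewrite dk; lia.
by rewrite iterS.
Qed.

Lemma path_par y i h : y \in Y -> dep y = i -> (h <= i)%N ->
  path e y (traject par (par y) h).
Proof.
move=> yY dy hi; apply/(pathP root) => k; rewrite size_traject => kh.
have -> : nth root (y :: traject par (par y) h) k = iter k par y.
  by rewrite -trajectS (set_nth_default y) ?size_traject 1?ltnW // nth_traject // ltnW.
rewrite (set_nth_default (par y)) ?size_traject // nth_traject // -iterSr.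
have [kY dk] := iter_parP yY dy (ltnW (leq_trans kh hi)).
have [|_ _] := parP kY (j := (i - k.+1)%N); first by rewrite dk; lia.
by rewrite e_sym.
Qed.

(** The two ends climb to their first common ancestor, [h + 1] levels up. The path stays at depth
    [i] while the branches descend strictly in depth, so nothing is visited twice. *)
Lemma has_cycle_tree x q i h :
  path e x q -> uniq (x :: q) -> (0 < size q)%N ->
  (forall y, y \in x :: q -> y \in Y /\ dep y = i) -> (h < i)%N ->
  iter h.+1 par x = iter h.+1 par (last x q) ->
  iter h par x <> iter h par (last x q) ->
  has_cycle e (h.+1.*2 + size q)%N.
Proof.
move=> epath; case/lastP: q epath => [//|q b]; rewrite size_rcons last_rcons.
move=> epath uq _ qY hi meet apart.
have [xY dx] : x \in Y /\ dep x = i by apply: qY; rewrite mem_head.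
have [bY db] : b \in Y /\ dep b = i.
  by apply: qY; rewrite inE mem_rcons mem_head orbT.
set w := iter h.+1 par x.
(* Here [q] has lost its last vertex [b], which reappears as the first vertex of
   [traject par b h.+1]. *)
pose c := w :: rev (traject par x h.+1) ++ q ++ traject par b h.+1.
have sc : size c = (h.+1.*2 + (size q).+1)%N.
  by rewrite /c -cat1s !size_cat size_rev !size_traject /=; lia.
have depx k : (k <= h.+1)%N -> dep (iter k par x) = (i - k)%N.
  by move=> kh; have [] := iter_parP xY dx (leq_trans kh hi).
have depb k : (k <= h.+1)%N -> dep (iter k par b) = (i - k)%N.
  by move=> kh; have [] := iter_parP bY db (leq_trans kh hi).
have memt y k : y \in traject par k h.+1 -> exists2 j, (j <= h)%N & y = iter j par k.
  by move=> /trajectP[j jh ->]; exists j.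
(* Branches that have merged stay merged, so being apart at height [h] means being apart at every
   lower height. *)
have apart_le k : (k <= h)%N -> iter k par x <> iter k par b.
  by move=> kh E; apply: apart; rewrite -(subnK kh) !iterD E.
have utraj z : z \in Y -> dep z = i -> uniq (traject par z h.+1).
  move=> zY dz; apply/(uniqP root) => j k; rewrite !inE size_traject => jh kh.
  rewrite !(set_nth_default z root) ?size_traject // !nth_traject //.
  have [_ dj] := iter_parP zY dz (leq_trans (ltnW jh) hi).
  have [_ dk] := iter_parP zY dz (leq_trans (ltnW kh) hi).
  by move=> /(congr1 dep); rewrite dj dk; lia.
have uc : uniq c.
  rewrite /c cons_uniq cat_uniq rev_uniq cat_uniq !utraj //.
  have [/= xq uqb] : (x \notin rcons q b) /\ uniq (rcons q b) by apply/andP.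
  have dq y : y \in q -> dep y = i.
    by move=> yq; have [] := qY y; rewrite // inE mem_rcons inE yq !orbT.
  move: uqb; rewrite rcons_uniq => /andP[bq ->]; rewrite !andTb andbT.
  have dw : dep w = (i - h.+1)%N by rewrite depx.
  apply/and3P; split.
  - rewrite !mem_cat mem_rev; apply/negP => /or3P[/memt[j jh E]|/dq|/memt[j jh E]].
    + by have := depx j; rewrite -E dw; lia.
    + by rewrite dw; lia.
    + by have := depb j; rewrite -E dw; lia.
  - apply/hasPn => y; rewrite mem_rev mem_cat.
    apply: contraL => /memt[j jh ->].
    rewrite negb_or; apply/andP; split.
      apply/negP => jq; have := dq _ jq; rewrite depx; last by lia.
      case: j jh jq => [|j] jh jq; last by lia.
      by move: xq; rewrite mem_rcons inE jq orbT.
    apply/negP => /memt[k kh E]; have jk : j = k.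
      by have := congr1 dep E; rewrite depx ?depb; lia.
    by move: E; rewrite jk; apply: apart_le.
  - rewrite -[X in ~~ X]/(has (mem q) (traject par b h.+1)).
    apply/hasPn => y /memt[j jh ->]; apply/negP => jq.
    have := dq _ jq; rewrite depb; last by lia.
    case: j jh jq => [|j] jh jq; last by lia.
    by move: jq => /= jq; rewrite jq in bq.
have ec : cycle e c.
  rewrite /c /= rcons_cat cat_path; apply/andP; split.
    have := path_par xY dx hi; rewrite -rev_path.
    have -> : last x (traject par (par x) h.+1) = w.
      by rewrite last_traject.
    have -> : belast x (traject par (par x) h.+1) = traject par x h.+1.
      by rewrite [in LHS]trajectSr belast_rcons -trajectS.
    by rewrite (eq_path (e' := e)) // => y z; rewrite e_sym.
  have -> : last w (rev (traject par x h.+1)) = x.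
    by rewrite trajectS rev_cons last_rcons.
  rewrite rcons_cat /= -cat_rcons cat_path epath last_rcons /=.
  have -> : w = iter h.+1 par b by [].
  by rewrite iterSr -trajectSr; apply: path_par bY db hi.
rewrite -sc; apply/andP; split; first by rewrite sc; lia.
by apply/existsP; exists (in_tuple c); apply/andP.
Qed.

(* At the deepest level where the vertices of the theta graph still have at
   least two distinct ancestors, colour each vertex by its ancestor: the ends
   of a bichromatic path are joined through the tree by a path whose length
   2h does not depend on the ends. *)
Lemma has_cycle_theta (g : int -> V) (N p : int) (i t : nat) :
  (forall x, g (x + N) = g x) ->
  (forall x y, `|x - y| < N -> g x = g y -> x = y) ->
  (forall x, e (g x) (g (x + 1))) -> 1 < p < N - 1 -> e (g 0) (g p) ->
  (forall x, g x \in Y /\ dep (g x) = i) ->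
  odd t -> (i.*2 < t)%N -> t%:Z * 2 <= N -> has_cycle e t.
Proof.
move=> g_per g_inj g_edge p_range chord gY t_odd it tN.
pose merged h := `[< forall x, iter h par (g x) = iter h par (g 0) >].
have merged_i : merged i.
  apply/asboolP => x.
  suff E y : iter i par (g y) = root by rewrite !E.
  have [gyY dy] := gY y; have [iY di] := iter_parP gyY dy (leqnn i).
  by apply: dep0 => //; rewrite di subnn.
have [h0 hM hmin] := ex_minnP (ex_intro merged i merged_i).
have hi := hmin _ merged_i.
case: h0 hM hmin hi => [|h] /asboolP hM hmin hi.
  by have /g_inj : g 1 = g 0 := hM 1; lia.
have /asboolPn/existsNP[x ncol] : ~~ merged h.
  by apply/negP => /hmin; rewrite ltnn.
pose col y := iter h par y == iter h par (g 0).
(* The tree supplies [2 (h + 1) <= 2 i < t] edges, an even number, so the length left for the path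
   is odd and positive. *)
have [|||y [q [eq uq sq cq img]]] := @bichromatic_path_theta V e g N p col
   (t - h.+1.*2) e_sym g_per g_inj g_edge p_range chord.
- by rewrite oddB; [rewrite odd_double addbF | lia].
- by lia.
- by exists x; rewrite /col eqxx => /eqP.
have img' z : z \in y :: q -> z \in Y /\ dep z = i by move=> /img[j ->].
have -> : t = (h.+1.*2 + size q)%N by lia.
apply: (@has_cycle_tree y q i h) => //; first by lia.
- have [j yE] := img _ (mem_head y q).
  by have [k lE] := img _ (mem_last y q); rewrite lE yE !hM.
- by move=> E; move: cq; rewrite /col E eqxx.
Qed.
End TreeCycles.

(** * Closed neighbourhoods and rotations of sequences *)

Definition closed_nbhd (V : finType) (e : rel V) (X Y : {set V}) : {set V} :=
  [set z in X | (z \in Y) || [exists y in Y, e y z]].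

Lemma closed_nbhdS (V : finType) (e : rel V) (X Y Z : {set V}) :
  Y \subset Z -> closed_nbhd e X Y \subset closed_nbhd e X Z.
Proof.
move=> YZ; apply/subsetP => z; rewrite !inE => /andP[-> /orP[zY|]] /=.
  by rewrite (subsetP YZ).
case/existsP=> y /andP[yY eyz]; apply/orP; right; apply/existsP; exists y.
by rewrite (subsetP YZ).
Qed.

(** Reversing the initial segment changes a single link, the one into [y]. The relation is arbitrary
    because the lemma serves both for adjacency and for an invariant of rotations. *)
Lemma sorted_rotation (T : Type) (r : rel T) (x y : T) (c a : seq T) :
  symmetric r -> sorted r (x :: c ++ y :: a) -> r x y ->
  sorted r (rev (x :: c) ++ y :: a).
Proof.
move=> r_sym; rewrite -cat_cons !sorted_cat_cons => /andP[xc ->] rxy.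
rewrite andbT -rev_cons rev_sorted /= rxy /=.
move: xc; rewrite /= rcons_path => /andP[xc _].
by rewrite (eq_path (e' := r)) // => u v; rewrite r_sym.
Qed.

Lemma split_last_has (T : Type) (P : pred T) (s : seq T) : has P s ->
  exists b u a, [/\ s = b ++ u :: a, P u & all (predC P) a].
Proof.
elim: s => //= x s IH; case: (boolP (has P s)) => [/IH[b [u [a [-> Pu Pa]]]] _|hs].
  by exists (x :: b), u, a.
by rewrite orbF => Px; exists [::], x, s; rewrite all_predC.
Qed.

(** * Posa rotations *)

Section Rotation.
Variables (V : finType) (e : rel V).
Hypotheses (e_sym : symmetric e) (e_irr : irreflexive e).
Variables (X : {set V}) (q0 : seq V).
Hypotheses (q0_path : sorted e q0) (q0_uniq : uniq q0)
  (q0X : {subset q0 <= X}).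
Hypothesis q0_max : forall q : seq V, sorted e q -> uniq q ->
  {subset q <= X} -> (size q <= size q0)%N.

(* The moving end of the rotated path is the head of the sequence. *)
Inductive rotated : seq V -> Prop :=
| rotated0 : rotated q0
| rotatedS x c y a : rotated (x :: c ++ y :: a) -> e x y ->
    rotated (rev (x :: c) ++ y :: a).

Definition heads : {set V} := [set x | `[< exists t, rotated (x :: t) >]].

Lemma headsP x : reflect (exists t, rotated (x :: t)) (x \in heads).
Proof. by rewrite inE; apply: asboolP. Qed.

Lemma rotated_path q : rotated q -> sorted e q /\ perm_eq q q0.
Proof.
elim=> [|x c y a _ [eq pq] exy]; first by [].
split; first exact: sorted_rotation.
by rewrite -(permPr pq) -cat_cons perm_cat2r perm_rev.
Qed.

(** Otherwise putting [y] in front would give a path in [X] longer than [q0]. *)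
Lemma head_nbrs x t y : rotated (x :: t) -> e x y -> y \in X -> y \in t.
Proof.
move=> rt exy yX; apply/negPn/negP => yt.
have [eq pq] := rotated_path rt.
have /(_ (y :: x :: t)) := q0_max; rewrite -(perm_size pq) => /(_ _ _ _)/= H.
suff : ((size t).+2 <= (size t).+1)%N by rewrite ltnn.
apply: H.
- by rewrite e_sym exy.
- have : uniq (x :: t) by rewrite (perm_uniq pq).
  move=> /= ->; rewrite inE negb_or yt !andbT.
  by apply: contraTneq exy => ->; rewrite e_irr.
- move=> z; rewrite in_cons => /orP[/eqP->//|]; rewrite (perm_mem pq).
  exact: q0X.
Qed.

(** At the ends of [q0] the missing neighbour is [v] itself: by the default of [nth] for [succ0],
    and because [0.-1] is 0 for [pred0]. *)
Definition succ0 v := nth v q0 (index v q0).+1.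
Definition pred0 v := nth v q0 (index v q0).-1.

Lemma heads_nbr x y : x \in heads -> e x y -> y \in X -> y \notin heads ->
  y \in succ0 @: heads :|: pred0 @: heads.
Proof.
case/headsP=> t rt exy yX yS; apply: contraT => nadj.
(* If y kept its neighbours of q0 throughout all rotations, rotating at y
   would turn one of them into a head. *)
pose adj y v := (y == succ0 v) || (y == pred0 v).
have nadjP w : w \in heads -> ~~ adj y w.
  move=> wS; apply: contra nadj; rewrite inE /adj => /orP[] /eqP->.
    by rewrite imset_f.
  by rewrite [X in _ || X]imset_f ?orbT.
(* [sorted D q] says that each vertex next to [y] in [q] is already next to [y] in [q0]. *)
pose D := [rel u v | ((u == y) ==> adj y v) && ((v == y) ==> adj y u)].
have D_sym : symmetric D by move=> u v; rewrite /= andbC.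
have DP q : rotated q -> sorted D q.
  elim=> [|x' c y' a rq Dq exy'].
    apply/(sortedP x) => i iq; rewrite /= /adj /succ0 /pred0.
    set u := nth x q0 i; set v := nth x q0 i.+1.
    have iu : index u q0 = i by rewrite index_uniq // ltnW.
    have iv : index v q0 = i.+1 by rewrite index_uniq.
    rewrite iu iv /= (set_nth_default x u iq) (set_nth_default x v (ltnW iq)).
    rewrite -/u -/v.
    by apply/andP; split; apply/implyP => /eqP<-; rewrite eqxx ?orbT.
  apply: sorted_rotation => //=.
  have x'S : x' \in heads by apply/headsP; exists (c ++ y' :: a).
  apply/andP; split; apply/implyP => /eqP yE.
    by rewrite -yE x'S in yS.
  have wS : last x' c \in heads.
    apply/headsP; have := rotatedS rq exy'.
    by case/lastP: (c) => [|c' w]; [exists (y' :: a) |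
      rewrite last_rcons -rcons_cons rev_rcons; eexists; eauto].
  move: Dq; rewrite -cat_cons sorted_cat_cons /= rcons_path => /andP[/andP[_]].
  by rewrite /= yE eqxx (negbTE (nadjP _ wS)) /= andbF.
have yt := head_nbrs rt exy yX.
case/splitPr: yt rt => c a rt.
have yx : x <> y by move=> E; rewrite E e_irr in exy.
have wS : last x c \in heads.
  apply/headsP; have := rotatedS rt exy.
  by case/lastP: (c) => [|c' w]; [exists (y :: a) |
    rewrite last_rcons -rcons_cons rev_rcons; eexists; eauto].
have := DP _ rt; rewrite -cat_cons sorted_cat_cons /= rcons_path => /andP[/andP[_]].
by rewrite /= eqxx (negbTE (nadjP _ wS)) /= andbF.
Qed.

Let M := closed_nbhd e X heads.

Lemma heads_sub : heads \subset X.
Proof.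
apply/subsetP => x /headsP[t /rotated_path[_ pq]].
by apply: q0X; rewrite -(perm_mem pq) mem_head.
Qed.

(** Posa's bound: beyond itself, [heads] reaches only successors and predecessors along [q0], at
    most one of each per head. *)
Lemma card_nbhd_heads : (#|M| <= 3 * #|heads|)%N.
Proof.
have sub : M \subset heads :|: (succ0 @: heads :|: pred0 @: heads).
  apply/subsetP => y; rewrite inE => /andP[yX]; rewrite in_setU.
  case: (boolP (y \in heads)) => //= yS /existsP[x /andP[xS exy]].
  exact: (heads_nbr xS).
apply: leq_trans (subset_leq_card sub) _.
apply: leq_trans (leq_card_setU _ _) _; rewrite mulSn leq_add2l.
apply: leq_trans (leq_card_setU _ _) _; rewrite mul2n -addnn.
by apply: leq_add; apply: leq_imset_card.
Qed.

Lemma nbhd_heads_mem q y : rotated q -> y \in M -> y \in q.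
Proof.
move=> rq; rewrite inE => /andP[yX /orP[/headsP[t rt]|]].
  have [_ p1] := rotated_path rq; have [_ p2] := rotated_path rt.
  by rewrite (perm_mem p1) -(perm_mem p2) mem_head.
case/existsP=> x /andP[/headsP[t rt] exy].
have [_ p1] := rotated_path rq; have [_ p2] := rotated_path rt.
by rewrite (perm_mem p1) -(perm_mem p2) inE (head_nbrs rt exy yX) orbT.
Qed.

(** The last vertex [u] of [M] along [q0] keeps its position under all rotations, so [M] stays
    within the first [k + 1] vertices. A head adjacent to [u] closes this segment into a cycle. *)
Lemma long_cycle_at_head : (1 < #|M|)%N -> exists (x : V) (c : seq V),
  [/\ x \in heads, uniq (x :: c), cycle e (x :: c), {subset M <= x :: c} &
      {subset x :: c <= X}].
Proof.
move=> M1.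
have hasM : has (mem M) q0.
  have /card_gt0P[y yM] := ltnW M1.
  by apply/hasP; exists y => //; apply: nbhd_heads_mem yM; constructor.
(* No rotation reaches the part u :: a beyond the last vertex of M. *)
have [b [u [a [q0E uM aM]]]] := split_last_has hasM.
pose k := size b.
have inv q : rotated q -> drop k q = u :: a.
  elim=> [|x c y a' rq dq exy]; first by rewrite q0E drop_size_cat.
  have yM : y \in M.
    rewrite inE; apply/andP; split.
      have [_ pq] := rotated_path rq; apply: q0X.
      by rewrite -(perm_mem pq) -cat_cons mem_cat mem_head orbT.
    apply/orP; right; apply/existsP; exists x; rewrite exy andbT.
    by apply/headsP; exists (c ++ y :: a').
  (* The pivot [y] is adjacent to a head, hence in [M], hence not beyond [u]: only positions before
     [k] are reversed. *)
  have kc : (size (x :: c) <= k)%N.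
    rewrite leqNgt; apply/negP => kc.
    have : y \in a.
      have -> : a = drop k.+1 (x :: c ++ y :: a').
        by rewrite -[k.+1]add1n -drop_drop dq /= drop0.
      rewrite -cat_cons drop_cat; case: ifP => _.
        by rewrite mem_cat mem_head orbT.
      have -> : (k.+1 - size (x :: c) = 0)%N by lia.
      by rewrite drop0 mem_head.
    by move/(allP aM); rewrite /= yM.
  rewrite -dq -cat_cons !drop_cat size_rev.
  by rewrite ltnNge kc.
have Mc q : rotated q -> {subset M <= take k.+1 q}.
  move=> rq y yM; have := nbhd_heads_mem rq yM.
  rewrite -[in X in X -> _](cat_take_drop k.+1 q) mem_cat => /orP[//|].
  by rewrite -[k.+1]add1n -drop_drop (inv _ rq) /= drop0 => /(allP aM); rewrite /= yM.
have takeE q : rotated q -> take k.+1 q = rcons (take k q) u.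
  move=> rq; have kq : (k < size q)%N.
    by have := congr1 size (inv _ rq); rewrite size_drop /=; lia.
  rewrite (take_nth u) //; congr rcons.
  by rewrite -[k]addn0 -nth_drop (inv _ rq).
have /andP[uX] : (u \in X) && ((u \in heads) || [exists y in heads, e y u]).
  by move: uM; rewrite /= inE.
(* If [u] were a head, its fixed position [k] would be 0 and [M] would reduce to [u]. *)
case/orP=> [/headsP[t rt]|].
  have [_ pq] := rotated_path rt.
  have uq : uniq (u :: t) by rewrite (perm_uniq pq).
  have k0 : k = 0%N.
    case: (posnP k) => // k_gt0; move: (inv _ rt); rewrite -(prednK k_gt0) /=.
    by move=> E; move: uq; rewrite /= -(cat_take_drop k.-1 t) E mem_cat mem_head orbT.
  have /subset_leq_card : M \subset [set u].
    apply/subsetP => y yM; have := Mc _ rt _ yM.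
    by rewrite takeE // k0 /= !inE.
  by rewrite cards1 leqNgt M1.
case/existsP=> x /andP[xS exu]; move/headsP: (xS) => [t rt].
have k_gt0 : (0 < k)%N.
  rewrite lt0n; apply/eqP => k0; move: (inv _ rt); rewrite k0 drop0 => -[E _].
  by rewrite E e_irr in exu.
have [eq pq] := rotated_path rt.
have uq : uniq (x :: t) by rewrite (perm_uniq pq).
have cE : x :: take k t = take k.+1 (x :: t) by [].
exists x, (take k t); rewrite cE; split.
- done.
- exact: take_uniq.
- rewrite -cE /= rcons_path take_path //=.
  have -> : last x (take k t) = last x (x :: take k t) by [].
  by rewrite cE takeE // last_rcons e_sym.
- exact: Mc.
- move=> y /mem_take; rewrite (perm_mem pq); exact: q0X.
Qed.
End Rotation.

(** Expansion by 4 contradicts the bound 3 of rotations unless there are more than [m] heads. Then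
    [m] of them already have [4 * m] vertices in their closed neighbourhood, all on the cycle. *)
Lemma long_cycle_with_chord (V : finType) (e : rel V) (X : {set V}) (m : nat) :
  symmetric e -> irreflexive e -> X != finset.set0 -> (0 < m)%N ->
  (forall Y : {set V}, Y \subset X -> Y != finset.set0 -> (#|Y| <= m)%N ->
     (4 * #|Y| <= #|closed_nbhd e X Y|)%N) ->
  exists (x : V) (c : seq V) (p : nat),
  [/\ uniq (x :: c), cycle e (x :: c), {subset x :: c <= X},
      (4 * m <= size (x :: c))%N &
      [/\ (1 < p)%N, (p.+1 < size (x :: c))%N & e x (nth x (x :: c) p)]].
Proof.
move=> e_sym e_irr /set0Pn[x0 x0X] m_gt0 expX.
pose P n := `[< exists q : seq V,
  [/\ size q = n, sorted e q, uniq q & {subset q <= X}] >].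
have P1 : exists n, P n.
  by exists 1%N; apply/asboolP; exists [:: x0]; split=> // y; rewrite inE => /eqP->.
have Pub n : P n -> (n <= #|V|)%N.
  by move=> /asboolP[q [<- _ uq _]]; rewrite -(card_uniqP uq) max_card.
have [n0 /asboolP[q0 [sq0 eq0 uq0 q0X]] nmax] := ex_maxnP P1 Pub.
have q0max q : sorted e q -> uniq q -> {subset q <= X} -> (size q <= size q0)%N.
  by move=> eq uq qX; rewrite sq0; apply: nmax; apply/asboolP; exists q.
set S := heads e q0; set M := closed_nbhd e X S.
have SX : S \subset X by apply: heads_sub.
have S0 : S != finset.set0.
  case: q0 @S @M sq0 {eq0 uq0} q0X q0max SX => [|x t] S M sq0 q0X q0max SX.
    suff : (1 <= 0)%N by [].
    by apply: (q0max [:: x0]) => // y; rewrite inE => /eqP->.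
  by apply/set0Pn; exists x; apply/headsP; exists t; constructor.
have M3 : (#|M| <= 3 * #|S|)%N by apply: card_nbhd_heads.
have Sm : (m < #|S|)%N.
  rewrite ltnNge; apply/negP => Sm; have := expX _ SX S0 Sm.
  by move: S0; rewrite -card_gt0 -/M; lia.
have M4 : (4 * m <= #|M|)%N.
  pose S' := [set y in take m (enum S)].
  have S'S : S' \subset S.
    by apply/subsetP => y; rewrite inE => /mem_take; rewrite mem_enum.
  have cS' : #|S'| = m.
    rewrite cardsE (card_uniqP _) ?take_uniq ?enum_uniq //.
    by rewrite size_takel // -cardE ltnW.
  have := expX S' (subset_trans S'S SX); rewrite -card_gt0 cS' => /(_ m_gt0 (leqnn _)).
  move=> /leq_trans; apply; exact: subset_leq_card (closed_nbhdS _ _ S'S).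
have [|x [c [xS uc ec Mc cX]]] :=
  @long_cycle_at_head V e e_sym e_irr X q0 eq0 uq0 q0X q0max.
  by rewrite -/S -/M; lia.
have xX := subsetP SX _ xS.
have Mle : (#|M| <= size (x :: c))%N.
  by rewrite -(card_uniqP uc); apply: subset_leq_card; apply/subsetP.
(* For the chord: [x] has at least three neighbours in [X], all on the cycle, so one of them is not
   next to [x] there. *)
have : (4 <= #|closed_nbhd e X [set x]|)%N.
  have := expX [set x]; rewrite sub1set cards1 => /(_ xX _ m_gt0) H.
  by rewrite -[4%N]/(4 * 1)%N; apply: H; apply/set0Pn; exists x; rewrite inE.
move=> H4.
have [z] : exists z,
    z \in closed_nbhd e X [set x] :\: [set x; nth x (x :: c) 1; last x c].
  apply/card_gt0P; rewrite cardsD subn_gt0.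
  apply: leq_ltn_trans (subset_leq_card (subsetIr _ _)) _.
  apply: leq_ltn_trans _ H4.
  apply: leq_trans (leq_card_setU _ _) _; rewrite cards1 addn1 ltnS.
  by rewrite cards2; case: eqP.
rewrite in_setD => /andP[zn zN].
move: zn; rewrite !inE !negb_or => /andP[/andP[zx z1] zl].
have exz : e x z.
  move: zN; rewrite !inE (negbTE zx) /= => /andP[_ /existsP[y]].
  by rewrite inE => /andP[/eqP->].
have zc : z \in x :: c.
  by apply: Mc; apply: (subsetP (closed_nbhdS e X _)) zN; rewrite sub1set.
set p := index z (x :: c).
have pc : (p < size (x :: c))%N by rewrite index_mem.
have pz : nth x (x :: c) p = z by rewrite nth_index.
exists x, c, p; split=> //; first exact: leq_trans M4 Mle.
rewrite pz; split=> //; clearbody p.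
- case: p pz {pc} => [|[|//]] E; first by rewrite -E eqxx in zx.
  by rewrite -E eqxx in z1.
- move: pc; rewrite leq_eqVlt => /orP[/eqP [pE]|//].
  by rewrite (last_nth x) -pE pz eqxx in zl.
Qed.

(** Reading the list at indices modulo its length gives the periodic map on the integers that
    [has_cycle_theta] takes. *)
Lemma has_cycle_theta_seq (V : finType) (e : rel V) (Y : {set V}) (root : V)
    (dep : V -> nat) (par : V -> V) (x : V) (c : seq V) (p i t : nat) :
  symmetric e ->
  (forall y, y \in Y -> dep y = 0%N -> y = root) ->
  (forall y j, y \in Y -> dep y = j.+1 ->
     [/\ par y \in Y, dep (par y) = j & e (par y) y]) ->
  uniq (x :: c) -> cycle e (x :: c) ->
  (forall y, y \in x :: c -> y \in Y /\ dep y = i) ->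
  (1 < p)%N -> (p.+1 < size (x :: c))%N -> e x (nth x (x :: c) p) ->
  odd t -> (i.*2 < t)%N -> (t * 2 <= size (x :: c))%N -> has_cycle e t.
Proof.
move=> e_sym dep0 parP uc ec cY p1 pc chord t_odd it tc.
pose N : int := size (x :: c).
pose g (z : int) := nth x (x :: c) `|(z %% N)%Z|%N.
have N_gt0 : 0 < N by [].
have N_neq0 : N != 0 by [].
have idx z : (`|(z %% N)%Z| < size (x :: c))%N.
  by have := modz_ge0 z N_neq0; have := ltz_pmod z N_gt0; rewrite /N; lia.
have gE (j : nat) : (j < size (x :: c))%N -> g j = nth x (x :: c) j.
  by move=> jc; rewrite /g modz_small // /N; lia.
have g_per z : g (z + N) = g z by rewrite /g modzDr.
apply: (@has_cycle_theta V e e_sym Y root dep par dep0 parP g N p i t) => //.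
- move=> y z yz /eqP; rewrite nth_uniq // => /eqP E.
  have {}E : (y %% N)%Z = (z %% N)%Z.
    by have := modz_ge0 y N_neq0; have := modz_ge0 z N_neq0; lia.
  have := divz_eq y N; have := divz_eq z N; rewrite E.
  move: ((y %/ N)%Z) ((z %/ N)%Z) => a b zE yE.
  have ab : a = b by nia.
  by rewrite zE yE ab.
- move=> z; rewrite -[e _ _]/(e (nth x (x :: c) _) _).
  have -> : g (z + 1) = g ((z %% N)%Z + 1) by rewrite /g modzDml.
  have : (z %% N)%Z = `|(z %% N)%Z|%N by have := modz_ge0 z N_neq0; lia.
  move: (idx z) => /[swap] -> ; set j := `|_|%N => jc.
  have : path e x (rcons c x) by [].
  move/(pathP x)/(_ j); rewrite size_rcons => /(_ jc).
  rewrite -rcons_cons nth_rcons jc => {}ec.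
  suff <- : nth x (rcons c x) j = g (j%:Z + 1) by [].
  rewrite nth_rcons; case: ltngtP => jc'; last 1 first.
  + have -> : j%:Z + 1 = 0 + N by rewrite /N /= intS jc' addrC add0r.
    by rewrite g_per (gE 0%N).
  + by rewrite addrC -intS gE.
  + by move: jc => /=; lia.
- by rewrite /N; lia.
- by rewrite (gE 0%N) // gE //; lia.
- by move=> z; apply: cY; apply: mem_nth; apply: idx.
Qed.

(** * Independence ratios *)

Section Alpha.
Variables (V : finType) (e : rel V).
Hypotheses (e_sym : symmetric e) (e_irr : irreflexive e).

Lemma alphaP (X : {set V}) : exists S : {set V},
  [/\ S \subset X, independent e S & #|S| = alpha e X].
Proof.
have [|S /andP[SX iS] E] := @eq_bigmax_cond _
    [pred S : {set V} | (S \subset X) && independent e S] (fun S => #|S|).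
  apply/card_gt0P; exists finset.set0; rewrite inE sub0set.
  by apply/forallP => x; rewrite inE.
by exists S; split=> //; rewrite -E.
Qed.

Lemma alpha_max (X S : {set V}) :
  S \subset X -> independent e S -> (#|S| <= alpha e X)%N.
Proof. by move=> SX iS; rewrite /alpha (bigop.bigmax_sup S) // SX. Qed.

Lemma alphaS (X Z : {set V}) : X \subset Z -> (alpha e X <= alpha e Z)%N.
Proof.
move=> XZ; have [S [SX iS <-]] := alphaP X.
exact: alpha_max (subset_trans SX XZ) iS.
Qed.

Lemma alpha_gt0 (X : {set V}) : X != finset.set0 -> (0 < alpha e X)%N.
Proof.
move=> /set0Pn[x xX]; rewrite -(cards1 x); apply: alpha_max.
  by rewrite sub1set.
apply/forall_inP => y /set1P->; apply/forall_inP => z /set1P->.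
by rewrite e_irr.
Qed.

Lemma alphaD (X A B : {set V}) : A \subset X -> B \subset X ->
  [disjoint A & B] -> (forall x y, x \in A -> y \in B -> ~~ e x y) ->
  (alpha e A + alpha e B <= alpha e X)%N.
Proof.
move=> AX BX dAB nAB.
have [S [SA iS <-]] := alphaP A; have [T [TB iT <-]] := alphaP B.
have dST : [disjoint S & T] by apply: disjointWl SA (disjointWr TB dAB).
have -> : (#|S| + #|T|)%N = #|S :|: T|.
  by apply/esym/eqP; rewrite (leq_card_setU S T).2.
apply: alpha_max; first by rewrite subUset (subset_trans SA) // (subset_trans TB).
apply/forall_inP => x xST; apply/forall_inP => y yST.
case/setUP: xST => xs; case/setUP: yST => ys.
- exact: (forall_inP (forall_inP iS x xs)).
- exact: nAB (subsetP SA _ xs) (subsetP TB _ ys).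
- by rewrite e_sym; apply: nAB (subsetP SA _ ys) (subsetP TB _ xs).
- exact: (forall_inP (forall_inP iT x xs)).
Qed.

Variable R : realFieldType.
Implicit Types k K : R.

(** A division-free form of [|X| / alpha(X) >= k]. The inequality alone would hold for the empty set
    with every [k]. *)
Definition ratio_ge k (X : {set V}) : Prop :=
  X != finset.set0 /\ k * (alpha e X)%:R <= #|X|%:R.

(** Averaging: no edge joins two fibres, so their independence numbers add up. If one fibre has
    ratio below [k], the remaining ones together have ratio above [k], and the induction continues
    there. *)
Lemma ratio_fiber k (f : V -> nat) (W : {set V}) : 0 <= k ->
  (forall x y, x \in W -> y \in W -> e x y -> f x = f y) -> ratio_ge k W ->
  exists j, ratio_ge k [set x in W | f x == j].
Proof.
move=> k_ge0; have [n] := ubnP #|W|; elim: n W => // n IH W Wn fW [W0 kW].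
have /set0Pn[w wW] := W0.
set W1 := [set x in W | f x == f w].
have W10 : W1 != finset.set0 by apply/set0Pn; exists w; rewrite inE wW eqxx.
have [W1k|W1k] := leP (k * (alpha e W1)%:R) #|W1|%:R; first by exists (f w).
have W1W : W1 \subset W by apply/subsetP => x; rewrite inE => /andP[].
have cW : #|W| = (#|W1| + #|W :\: W1|)%N.
  by rewrite -(cardsID W1 W) (setIidPr W1W).
have aW : (alpha e W1 + alpha e (W :\: W1) <= alpha e W)%N.
  apply: alphaD => //; first exact: subsetDl.
    by rewrite -setI_eq0; apply/eqP/setP => x; rewrite !inE; case: (x \in W); case: eqP.
  move=> x y; rewrite !inE => /andP[xW /eqP fx] /andP[+ yW]; rewrite yW /=.
  by apply: contra => exy; rewrite -fx (fW _ _ xW yW).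
have kW2 : k * (alpha e (W :\: W1))%:R < #|W :\: W1|%:R.
  move: kW; rewrite cW natrD => kW.
  have : k * (alpha e W1 + alpha e (W :\: W1))%:R <= k * (alpha e W)%:R.
    by rewrite ler_wpM2l // ler_nat.
  rewrite natrD mulrDr; lra.
have W20 : W :\: W1 != finset.set0.
  rewrite -card_gt0 -(ltr_nat R); apply: le_lt_trans kW2.
  by rewrite mulr_ge0.
have [|||j [j0 jk]] := IH (W :\: W1).
- by move: W10 Wn; rewrite -card_gt0 cW; clear; lia.
- by move=> x y /setDP[xW _] /setDP[yW _]; apply: fW.
- by split=> //; apply: ltW.
exists j.
have jw : j != f w.
  move/set0Pn: j0 => [y]; rewrite !inE => /andP[/andP[+ yW] /eqP <-].
  by rewrite yW.
have <- : [set x in W :\: W1 | f x == j] = [set x in W | f x == j].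
  apply/setP => x; rewrite !inE; case: (x \in W) => //=; rewrite ?andbF // andbT.
  have [fx|] := eqVneq (f x) j; rewrite ?andbF // andbT.
  by rewrite fx.
by [].
Qed.
End Alpha.

(** * Breadth-first layers *)

Section Ball.
Variables (V : finType) (e : rel V).
Hypotheses (e_sym : symmetric e) (e_irr : irreflexive e).
Implicit Types (X Z L : {set V}) (v x y : V) (j : nat).

Fixpoint ball (X : {set V}) (v : V) (j : nat) : {set V} :=
  if j is j'.+1 then closed_nbhd e X (ball X v j') else [set v].

Lemma ball_subset X v j : v \in X -> ball X v j \subset X.
Proof.
move=> vX; case: j => [|j] /=; first by rewrite sub1set.
by apply/subsetP => z; rewrite inE => /andP[].
Qed.

Lemma ball_step X v j x y : x \in ball X v j -> y \in X -> e x y ->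
  y \in ball X v j.+1.
Proof.
move=> xB yX exy; rewrite inE yX /=; apply/orP; right.
by apply/existsP; exists x; rewrite xB.
Qed.

Lemma ballS X v j : v \in X -> ball X v j \subset ball X v j.+1.
Proof.
move=> vX; apply/subsetP => z zB; rewrite inE zB andbT.
exact: (subsetP (ball_subset j vX)).
Qed.

(** Otherwise the ball of radius [rho + 1] would have more than [K ^+ rho] vertices. *)
Lemma ball_growth (R : realFieldType) (K : R) X v rho : v \in X -> 1 <= K ->
  #|X|%:R <= K ^+ rho -> exists2 i, (i <= rho)%N &
  #|ball X v i.+1|%:R <= K * #|ball X v i|%:R.
Proof.
move=> vX K1 XK; apply: contrapT => nex.
have K0 : 0 < K by apply: lt_le_trans K1.
have big i : (i <= rho.+1)%N -> K ^+ i <= #|ball X v i|%:R.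
  elim: i => [|i IH] ir; first by rewrite expr0 /= cards1.
  have [H|H] := leP #|ball X v i.+1|%:R (K * #|ball X v i|%:R).
    by case: nex; exists i.
  by apply: le_trans (ltW H); rewrite exprS ler_pM2l // IH // ltnW.
have [H|H] := leP #|ball X v rho.+1|%:R (K * #|ball X v rho|%:R).
  by case: nex; exists rho.
have : K ^+ rho < #|ball X v rho.+1|%:R.
  apply: le_lt_trans H; apply: le_trans (_ : K * K ^+ rho <= _).
    by rewrite ler_peMl // exprn_ge0 // ltW.
  by rewrite ler_pM2l // big.
apply/negP; rewrite -leNgt; apply: le_trans XK.
by rewrite ler_nat subset_leq_card // ball_subset.
Qed.

(** If the slowly growing ball [Y] fails, then [|Y'| <= K |Y| < k alpha(Y)]. No edge joins [Y] to
    [X :\: Y'], so deleting [Y'] lowers [alpha] by at least [alpha(Y)] and keeps the ratio at least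
    [k]. *)
Lemma ratio_ball (R : realFieldType) (k K : R) X rho : 0 <= k -> 1 <= K ->
  ratio_ge e k X -> #|X|%:R <= K ^+ rho ->
  exists (X' : {set V}) v i, [/\ X' \subset X, v \in X', (i <= rho)%N &
    k * (alpha e (ball X' v i))%:R <= K * #|ball X' v i|%:R].
Proof.
move=> k0 K1; have [n] := ubnP #|X|; elim: n X => // n IH X Xn [X0 kX] XK.
have /set0Pn[v vX] := X0.
have [i ir gi] := ball_growth vX K1 XK.
set Y := ball X v i in gi; set Y' := ball X v i.+1 in gi.
have [Yk|Yk] := leP (k * (alpha e Y)%:R) (K * #|Y|%:R).
  by exists X, v, i; split.
have Y'X : Y' \subset X by apply: ball_subset.
have YY' : Y \subset Y' by apply: ballS.
have cX : #|X| = (#|Y'| + #|X :\: Y'|)%N.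
  by rewrite -(cardsID Y' X) (setIidPr Y'X).
have aX : (alpha e Y + alpha e (X :\: Y') <= alpha e X)%N.
  apply: alphaD => //; [exact: subset_trans Y'X | exact: subsetDl | |].
    rewrite disjoints_subset; apply/subsetP => x xY.
    by rewrite in_setC in_setD (subsetP YY' _ xY).
  move=> x y xY; rewrite in_setD => /andP[yY' yX]; apply: contra yY' => exy.
  exact: ball_step xY yX exy.
have kX' : k * (alpha e (X :\: Y'))%:R < #|X :\: Y'|%:R.
  move: kX; rewrite cX natrD => kX.
  have : k * (alpha e Y + alpha e (X :\: Y'))%:R <= k * (alpha e X)%:R.
    by rewrite ler_wpM2l // ler_nat.
  rewrite natrD mulrDr; lra.
have X'0 : X :\: Y' != finset.set0.
  rewrite -card_gt0 -(ltr_nat R); apply: le_lt_trans kX'.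
  by rewrite mulr_ge0.
have Y'0 : (0 < #|Y'|)%N.
  apply: leq_trans (subset_leq_card YY').
  rewrite lt0n; apply/eqP => Y0; move: Yk; rewrite Y0 mulr0.
  have -> : alpha e Y = 0%N.
    have [S [SY _ <-]] := alphaP e Y.
    by apply/eqP; rewrite -leqn0 -Y0 subset_leq_card.
  by rewrite mulr0 ltxx.
have [|||X' [w [j [X'X wX' jr kj]]]] := IH (X :\: Y').
- rewrite -ltnS; apply: leq_trans Xn; rewrite ltnS cX.
  by rewrite -[X in (X < _)%N]add0n ltn_add2r.
- by split=> //; apply: ltW.
- by apply: le_trans XK; rewrite ler_nat subset_leq_card // subsetDl.
by exists X', w, j; split=> //; apply: subset_trans X'X (subsetDl _ _).
Qed.

Section Depth.
Variables (X : {set V}) (v : V) (r : nat).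
Hypothesis vX : v \in X.
Let Y := ball X v r.

(** The distance from [v] inside [X] for vertices of [Y]; elsewhere the search fails and gives
    [r + 1]. *)
Definition depth y := find (fun j => y \in ball X v j) (iota 0 r.+1).
Definition parent y := odflt y [pick x in Y | e x y && ((depth x).+1 == depth y)].

Lemma depthP y : y \in Y -> (depth y <= r)%N /\ y \in ball X v (depth y).
Proof.
move=> yY; have H : has (fun j => y \in ball X v j) (iota 0 r.+1).
  by apply/hasP; exists r; rewrite ?mem_iota ?add0n ?ltnSn.
have dr : (depth y <= r)%N by move: H; rewrite has_find size_iota ltnS.
by split=> //; have := nth_find 0%N H; rewrite -/(depth y) nth_iota ?ltnS.
Qed.

Lemma depth_le y j : (j <= r)%N -> y \in ball X v j -> (depth y <= j)%N.
Proof.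
move=> jr yj; rewrite leqNgt; apply/negP => /(before_find 0%N).
by rewrite nth_iota ?ltnS // add0n yj.
Qed.

Lemma ball_leq i j : (i <= j)%N -> ball X v i \subset ball X v j.
Proof.
by move=> /subnK<-; elim: (j - i)%N => // d IH; rewrite addSn (subset_trans IH) ?ballS.
Qed.

Lemma depth_edge x y : x \in Y -> y \in Y -> e x y -> (depth y <= (depth x).+1)%N.
Proof.
move=> xY yY exy; have [xr xB] := depthP xY.
have [dr|dr] := ltnP (depth x) r; last by have [yr _] := depthP yY; lia.
apply: depth_le => //; apply: ball_step xB _ exy.
exact: (subsetP (ball_subset r vX)).
Qed.

Lemma depth0 y : y \in Y -> depth y = 0%N -> y = v.
Proof. by move=> /depthP[_ +] d0; rewrite d0 inE => /eqP. Qed.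

Lemma parentP y j : y \in Y -> depth y = j.+1 ->
  [/\ parent y \in Y, depth (parent y) = j & e (parent y) y].
Proof.
move=> yY dy; rewrite /parent; case: pickP => [x /and3P[xY exy /eqP dx]|none] /=.
  by split=> //; lia.
have [dr] := depthP yY; rewrite dy inE => /andP[yX /orP[yj|]].
  by have := depth_le _ yj; lia.
case/existsP=> x /andP[xj exy]; exfalso.
have jr : (j <= r)%N by lia.
have xY : x \in Y := subsetP (ball_leq jr) _ xj.
have := none x; rewrite xY exy /=.
have dx := depth_le jr xj; have := depth_edge xY yY exy.
by rewrite dy ltnS => jx; have -> : depth x = j; [lia | rewrite eqxx].
Qed.
End Depth.

(* Layers of equal parity are pairwise non-adjacent. *)
Lemma ratio_layer (R : realFieldType) (k : R) X v r : v \in X -> 0 <= k ->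
  ratio_ge e (2 * k) (ball X v r) ->
  exists j, ratio_ge e k [set y in ball X v r | depth X v r y == j].
Proof.
move=> vX k0 [Y0 kY]; set Y := ball X v r in Y0 kY *; set d := depth X v r.
pose W b := [set y in Y | odd (d y) == b].
have WY b : W b \subset Y by apply/subsetP => y; rewrite inE => /andP[].
have cY : #|Y| = (#|W true| + #|W false|)%N.
  rewrite -(cardsID (W true) Y) (setIidPr (WY _)); congr (_ + _)%N.
  by apply: eq_card => y; rewrite !inE; case: (y \in Y); case: (odd _).
(* The larger parity class keeps half of the vertices while [alpha] does not increase, which costs
   the factor 2. *)
have [b Wb] : exists b, (#|Y| <= 2 * #|W b|)%N.
  by have [H|H] := leqP #|W true| #|W false|; [exists false|exists true]; lia.
have rW : ratio_ge e k (W b).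
  split; first by move: Y0; rewrite -!card_gt0; lia.
  have : k * (alpha e (W b))%:R <= k * (alpha e Y)%:R.
    by rewrite ler_wpM2l // ler_nat alphaS.
  have : #|Y|%:R <= 2 * #|W b|%:R :> R by rewrite -natrM ler_nat.
  by lra.
have [|j [j0 kj]] := @ratio_fiber V e e_sym R k d (W b) k0 _ rW.
  move=> x y; rewrite !inE => /andP[xY /eqP ox] /andP[yY /eqP oy] exy.
  have := depth_edge vX xY yY exy; rewrite e_sym in exy.
  have := depth_edge vX yY xY exy; rewrite -/d => h1 h2.
  by move: h1 h2 ox; rewrite -oy; clear; lia.
exists j.
suff <- : [set x in W b | d x == j] = [set y in Y | d y == j] by [].
apply/setP => x; rewrite !inE; case: (x \in Y) => //=.
have [dx|//] := eqVneq (d x) j; rewrite ?andbF // andbT dx.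
case/set0Pn: j0 => y; rewrite !inE => /andP[/andP[_ oy] /eqP dy].
by rewrite -dy.
Qed.

(** The last bound is multiplicative so that it also covers the empty set: it is applied below to a
    difference that may be empty. *)
Lemma ratio_max (R : realFieldType) (L : {set V}) : L != finset.set0 ->
  exists (X : {set V}) (k : R), [/\ X \subset L, ratio_ge e k X, 0 < k,
    (forall l, ratio_ge e l L -> l <= k) &
    forall Z : {set V}, Z \subset L -> #|Z|%:R <= k * (alpha e Z)%:R].
Proof.
move=> L0.
pose f (Z : {set V}) : R := #|Z|%:R / (alpha e Z)%:R.
have PL : (L \subset L) && (L != finset.set0) by rewrite subxx.
have := @arg_maxP _ _ _ L (fun Z => (Z \subset L) && (Z != finset.set0)) f PL.
case: arg_maxP => // X /andP[XL X0] Xmax _.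
have a0 Z : Z != finset.set0 -> 0 < (alpha e Z)%:R :> R.
  by move=> /(alpha_gt0 e_irr); rewrite ltr0n.
exists X, (f X); split=> //.
- by split=> //; rewrite divfK // gt_eqF // a0.
- by rewrite divr_gt0 ?a0 // ltr0n card_gt0.
- move=> l [_ lL]; apply: le_trans (Xmax L PL).
  by rewrite ler_pdivlMr ?a0.
- move=> Z ZL; have [->|Z0] := eqVneq Z finset.set0.
    by rewrite cards0 mulr_ge0 // divr_ge0.
  by rewrite -ler_pdivrMr ?a0 //; apply: Xmax; rewrite ZL.
Qed.

(** The constant [8 * K] is 4, the expansion needed for rotations, times [2 * K], the loss in
    passing to a layer. The layer has depth at most [rho], whence [2 * rho < t]; the cycle in it has
    length at least [4 * m], whence [t <= 2 * m]. *)
Lemma odd_cycles_of_ratio (R : realFieldType) (k K : R) (X : {set V})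
    (rho m t : nat) :
  0 <= k -> 1 <= K -> ratio_ge e k X -> #|X|%:R <= K ^+ rho -> (0 < m)%N ->
  (forall Y : {set V}, Y \subset X -> Y != finset.set0 -> (#|Y| <= m)%N ->
     8 * K * #|Y|%:R <= k * (alpha e Y)%:R) ->
  odd t -> (rho.*2 < t)%N -> (t <= m.*2)%N -> has_cycle e t.
Proof.
move=> k0 K1 rX XK m0 small t_odd rt tm.
have K0 : 0 < K by apply: lt_le_trans K1.
have [X' [v [r [X'X vX' rr kr]]]] := ratio_ball k0 K1 rX XK.
set Y := ball X' v r in kr.
have Y0 : Y != finset.set0.
  by apply/set0Pn; exists v; apply: (subsetP (ball_leq _ (leq0n r))); rewrite ?inE.
have [||j rL] := @ratio_layer R (k / (2 * K)) X' v r vX' _ _.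
- by rewrite divr_ge0 // mulr_ge0 // ltW.
- split=> //; have -> : 2 * (k / (2 * K)) = k / K by field; lra.
  by rewrite mulrAC ler_pdivrMr // [_ * K]mulrC.
set L := [set y in _ | _] in rL.
have [L0 _] := rL.
have LY : L \subset Y by apply/subsetP => y; rewrite in_set => /andP[].
have LX : L \subset X by rewrite (subset_trans LY) // (subset_trans (ball_subset _ vX')).
have [X1 [k1 [X1L [X10 rX1] k1_gt0 k1max k1bd]]] := ratio_max R L0.
have k1k := k1max _ rL.
(* As X1 has maximal ratio k1, deleting the closed neighbourhood N of Z gives
   |X1| >= k1 alpha(Z) + |X1 :\: N|. *)
have expX1 (Z : {set V}) : Z \subset X1 -> Z != finset.set0 -> (#|Z| <= m)%N ->
    (4 * #|Z| <= #|closed_nbhd e X1 Z|)%N.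
  move=> ZX1 Z0 Zm; set N := closed_nbhd e X1 Z.
  have ZX : Z \subset X := subset_trans ZX1 (subset_trans X1L LX).
  have NX1 : N \subset X1 by apply/subsetP => y; rewrite inE => /andP[].
  have ZN : Z \subset N.
    by apply/subsetP => y yZ; rewrite inE yZ (subsetP ZX1).
  have cX1 : #|X1| = (#|N| + #|X1 :\: N|)%N.
    by rewrite -(cardsID N X1) (setIidPr NX1).
  have aX1 : (alpha e Z + alpha e (X1 :\: N) <= alpha e X1)%N.
    apply: alphaD => //; [exact: subsetDl | |].
      rewrite disjoints_subset; apply/subsetP => y yZ.
      by rewrite in_setC in_setD (subsetP ZN _ yZ).
    move=> x y xZ; rewrite in_setD => /andP[yN yX1]; apply: contra yN => exy.
    by rewrite inE yX1; apply/orP; right; apply/existsP; exists x; rewrite xZ.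
  have H1 : k1 * (alpha e Z + alpha e (X1 :\: N))%:R <= k1 * (alpha e X1)%:R.
    by rewrite ler_pM2l // ler_nat.
  have H2 := k1bd (X1 :\: N) (subset_trans (subsetDl _ _) X1L).
  have H3 := small _ ZX Z0 Zm.
  have H4 : k / (2 * K) * (alpha e Z)%:R <= k1 * (alpha e Z)%:R.
    by rewrite ler_wpM2r.
  have H5 : 4 * #|Z|%:R <= k / (2 * K) * (alpha e Z)%:R.
    by rewrite mulrAC ler_pdivlMr ?mulr_gt0 //; lra.
  rewrite -(ler_nat R) natrM.
  by move: rX1 H1; rewrite cX1 !natrD mulrDr; lra.
have [x [c [p [uc ec cX1 mc [p1 pc chord]]]]] :=
  long_cycle_with_chord e_sym e_irr X10 m0 expX1.
have cL y : y \in x :: c -> y \in Y /\ depth X' v r y = j.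
  by move=> /cX1/(subsetP X1L); rewrite in_set => /andP[yY /eqP].
have jr : (j <= r)%N.
  have [xY <-] := cL x (mem_head _ _).
  by have [] := depthP xY.
apply: (@has_cycle_theta_seq V e Y v (depth X' v r) (parent X' v r) x c p j t) => //.
- by move=> y; apply: depth0.
- by move=> y i; apply: parentP.
- by apply: leq_ltn_trans rt; rewrite leq_double (leq_trans jr).
- by move: mc tm; clear; lia.
Qed.
End Ball.

From mathcomp Require Import all_classical all_reals all_analysis.

(** * Summing the reciprocals *)

Section Reals.
Variable R : realType.
Implicit Types x y : R.

Lemma ln_le_tangent x y : 0 < x -> 0 < y -> ln y <= ln x + (y - x) / x.
Proof.
move=> x0 y0; have -> : y = x * (1 + (y - x) / x) by field; rewrite gt_eqF.
have z0 : 0 < 1 + (y - x) / x.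
  have -> : 1 + (y - x) / x = y / x by field; rewrite gt_eqF.
  exact: divr_gt0.
rewrite lnM ?posrE // lerD2l; apply: le_trans (le_ln1Dx _) _; first by lra.
by rewrite mulrDr mulr1 [x + _]addrC addrK mulrAC divff ?gt_eqF // mul1r.
Qed.

Lemma ln2_le1 : ln (2 : R) <= 1.
Proof. by have := ln_le_tangent ltr01 (ltr0n R 2); rewrite ln1 divr1; lra. Qed.

Lemma ln_exp2 n : ln (2 ^+ n : R) <= n%:R.
Proof. by rewrite lnXn // -(mulr_natl (ln 2)) ler_piMr // ln2_le1. Qed.

Lemma expR_ge_expn x n : 0 <= x -> (1 + x / n.+1%:R) ^+ n.+1 <= expR x.
Proof.
move=> x0; have -> : expR x = expR (x / n.+1%:R) ^+ n.+1.
  by rewrite -expRM_natr divfK.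
by apply: lerXn2r; rewrite ?nnegrE ?addr_ge0 ?divr_ge0 ?expR_ge0 // expR_ge1Dx.
Qed.

Lemma expR_le_exp4 x : 0 <= x -> expR x <= 4 ^+ (Num.truncn x).+1.
Proof.
move=> x0; apply: le_trans (_ : expR (Num.truncn x).+1%:R <= _).
  by rewrite ler_expR ltW // truncnS_gt.
rewrite -[_.+1%:R]mulr1 expRM_natl; apply: lerXn2r; rewrite ?nnegrE ?expR_ge0 //.
rewrite -[leRHS]lnK ?posrE // ler_expR.
(* The tangent at 1 gives this bound, which amounts to [e <= 4]. *)
have : ln (1 / 2 : R) <= - (1 / 2).
  have h0 : 0 < 1 / 2 :> R by lra.
  by have := ln_le_tangent ltr01 h0; rewrite ln1 divr1; lra.
have -> : (4 : R) = (1 / 2)^-1 ^+ 2 by field.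
rewrite lnXn ?invr_gt0 // lnV ?posrE //.
by lra.
Qed.

Lemma natr_doubleS n : n.*2.+1%:R = 2 * n%:R + 1 :> R.
Proof. by rewrite -natr1 -muln2 natrM mulrC. Qed.
End Reals.

(** * Lower bounds for the odd cycle sum *)

Section Main.
Variables (R : realType) (V : finType) (e : rel V).
Hypotheses (e_sym : symmetric e) (e_irr : irreflexive e).
Local Notation S := (odd_cycle_sum R e).
Implicit Types (X Y : {set V}) (k x : R).

Lemma odd_cycle_sum_ge0 : 0 <= S.
Proof. by apply: sumr_ge0 => t _; rewrite invr_ge0. Qed.

(** By concavity [ln (2c + 3) - ln (2c + 1) <= 2 / (2c + 1)], so the term of each odd length pays
    for half an increment of the logarithm. *)
Lemma odd_cycle_sum_interval (a b : nat) :
  (forall t, odd t -> (a.*2 < t)%N -> (t <= b.*2)%N -> has_cycle e t) ->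
  1 / 2 * (ln b.*2.+1%:R - ln a.*2.+1%:R) <= S.
Proof.
move=> cyc; have [ba|ab] := leqP b a.
  apply: le_trans odd_cycle_sum_ge0.
  rewrite pmulr_rle0 ?divr_gt0 // subr_le0 ler_ln ?posrE ?ltr0n //.
  by rewrite ler_nat ltnS leq_double.
have partial c : (a <= c <= b)%N -> 1 / 2 * (ln c.*2.+1%:R - ln a.*2.+1%:R) <=
    \sum_(0 <= t < c.*2 | odd_cycle_length e t) t%:R^-1 :> R.
  elim: c => [|c IH] /andP[ac cb].
    by move: ac; rewrite leqn0 => /eqP->; rewrite subrr mulr0 big_geq.
  move: ac; rewrite leq_eqVlt => /orP[/eqP<-|ac].
    by rewrite subrr mulr0 sumr_ge0 // => t _; rewrite invr_ge0.
  rewrite doubleS big_mkcond /= !big_nat_recr //= -big_mkcond /=.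
  have -> : odd_cycle_length e c.*2.+1.
    rewrite /odd_cycle_length /= odd_double /=; apply: cyc => /=.
    - by rewrite odd_double.
    - by rewrite ltnS leq_double.
    - by rewrite ltnW // -doubleS leq_double.
  have := IH; rewrite -ltnS ac (ltnW cb) => /(_ isT) {}IH.
  have h0 : 0 <= (if odd_cycle_length e c.*2 then c.*2%:R^-1 else 0) :> R.
    by case: ifP; rewrite ?invr_ge0.
  have h1 := @ln_le_tangent R c.*2.+1%:R c.*2.+3%:R (ltr0Sn _ _) (ltr0Sn _ _).
  have : (c.*2.+3%:R - c.*2.+1%:R) / c.*2.+1%:R = 2 * c.*2.+1%:R^-1 :> R.
    by rewrite -(addn2 c.*2.+1) natrD [_ + 2]addrC addrK.
  move=> E; move: IH h0 h1; rewrite E.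
  move: (ln c.*2.+3%:R) (ln c.*2.+1%:R) (ln a.*2.+1%:R) (c.*2.+1%:R^-1).
  move: (if _ then _ else _) (\sum_(_ <= _ < _ | _) _).
  by move=> u v w1 w2 w3 w4; lra.
apply: le_trans (partial b _) _; first by rewrite leqnn ltnW.
rewrite /odd_cycle_sum [leRHS](big_cat_nat (n := b.*2)) //=.
  by rewrite lerDl sumr_ge0 // => t _; rewrite invr_ge0.
(* The largest odd length in the interval is that of a cycle, hence at most the number of vertices:
   the partial sum lies within the full one. *)
case: b ab cyc {partial} => // b ab cyc; rewrite doubleS ltnS.
apply: (@odd_cycle_length_le V e); rewrite /odd_cycle_length /= odd_double /=.
apply: cyc; rewrite ?doubleS //= ?odd_double // ltnS leq_double.
by rewrite -ltnS.
Qed.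

Lemma ratio_le_card k X : 0 <= k -> ratio_ge e k X -> k <= #|X|%:R.
Proof.
move=> k0 [X0 kX]; apply: le_trans kX; rewrite ler_peMr //.
by rewrite ler1n alpha_gt0.
Qed.

Lemma small_set_ratio k (s : R) (m : nat) Y : 0 <= k -> 0 <= s -> s * m%:R <= k ->
  Y != finset.set0 -> (#|Y| <= m)%N -> s * #|Y|%:R <= k * (alpha e Y)%:R.
Proof.
move=> k0 s0 smk Y0 Ym; apply: le_trans (_ : k <= _).
  by apply: le_trans smk; rewrite ler_wpM2l // ler_nat.
by rewrite ler_peMr // ler1n alpha_gt0.
Qed.

(** With [K = s], the square root of [k], radius 8 suffices and lengths from 17 to [2 * m1] occur;
    [K = 4] gives those from about [8 ln k] to [2 * b]. The loss 10 bounds [ln 32 + ln 17]. *)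
Lemma sum_ge_poly_ratio k X : 0 < k -> 26 <= ln k -> ratio_ge e k X ->
  #|X|%:R <= k ^+ 4 -> 1 / 2 * (ln k - 10) <= S.
Proof.
move=> k0 lk rX Xk.
pose z := ln k / 2; pose s := expR z.
have z13 : 13 <= z by rewrite /z; lra.
have kE : k = expR (ln k) by rewrite lnK ?posrE.
have ss : s * s = k by rewrite -expRD /z -splitr -kE.
(* This makes the two ranges of lengths overlap: [rho <= m1]. *)
have s_ge : 64 * z + 16 <= s.
  apply: le_trans (@expR_ge_expn R z 6 _); last by rewrite /z; lra.
  set y := 1 + z / 7.
  have y2 : 8 <= y ^+ 2 by rewrite /y /z; nra.
  have y6 : 512 <= y ^+ 6.
    by rewrite (exprM y 2 3); move: y2; set w := y ^+ 2 => w8; rewrite !exprS expr0; nra.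
  have y0 : 0 <= y by rewrite /y /z; lra.
  have : 512 * y <= y ^+ 7 by rewrite [y ^+ 7]exprSr ler_wpM2r.
  by apply: le_trans; rewrite /y; lra.
have s0 : 0 < s by apply: expR_gt0.
pose m1 := Num.truncn (s / 8); pose b := Num.truncn (k / 32).
have m1_le : m1%:R <= s / 8 by rewrite truncn_le divr_ge0 // ltW.
have m1_gt : s / 8 < m1.+1%:R by apply: truncnS_gt.
have b_le : b%:R <= k / 32 by rewrite truncn_le divr_ge0 // ltW.
have b_gt : k / 32 < b.+1%:R by apply: truncnS_gt.
have ks : 400 * s <= k by rewrite -ss ler_pM2r //; lra.
have cyc t : odd t -> (8.*2 < t)%N -> (t <= b.*2)%N -> has_cycle e t.
  move=> t_odd t16 tb; have [tm|mt] := leqP t m1.*2.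
    apply: (@odd_cycles_of_ratio V e e_sym e_irr R k s X 8 m1 t) => //.
    - exact: ltW.
    - by lra.
    - by rewrite (exprM s 2 4) expr2 ss.
    - by rewrite truncn_gt0; lra.
    - move=> Y _ Y0 Ym; apply: small_set_ratio Y0 Ym => //; [exact: ltW | lra |].
      by have := ler_wpM2l (ltW s0) m1_le; rewrite -ss; lra.
  pose rho := (Num.truncn (4 * ln k)).+1.
  have rho_le : (Num.truncn (4 * ln k))%:R <= 4 * ln k.
    by rewrite truncn_le; lra.
  apply: (@odd_cycles_of_ratio V e e_sym e_irr R k 4 X rho b t) => //.
  - exact: ltW.
  - by lra.
  - apply: le_trans Xk _; apply: le_trans (expR_le_exp4 _); last by lra.
    by rewrite expRM_natl -kE.
  - by rewrite truncn_gt0; lra.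
  - move=> Y _ Y0 Ym; apply: small_set_ratio Y0 Ym => //; [exact: ltW | lra].
  - apply: leq_ltn_trans mt; rewrite leq_double -(ler_nat R).
    rewrite /rho -natr1; move: m1_gt; rewrite -natr1 /z in s_ge *; lra.
have := odd_cycle_sum_interval cyc; apply: le_trans.
rewrite ler_pM2l ?divr_gt0 //.
have h1 : ln (k / 2 ^+ 5) <= ln (b.*2.+1%:R : R).
  rewrite ler_ln ?posrE ?ltr0Sn ?divr_gt0 //.
  by rewrite natr_doubleS; move: b_gt; rewrite -(natr1 b); lra.
have h2 : ln (8.*2.+1%:R : R) <= 5.
  apply: le_trans (ln_exp2 R 5).
  by rewrite ler_ln ?posrE ?ltr0Sn ?exprn_gt0 // -natrX ler_nat.
rewrite ln_div ?posrE ?exprn_gt0 // in h1.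
have := ln_exp2 R 5.
by lra.
Qed.

(** Induction on [a], with [ln x] in place of [x]. The square in the hypothesis on [X] leaves room
    for the factor [k] in the size of the subset passed to; dividing the ratio by 32 costs at most
    5/2 of the 8 allowed. *)
Lemma sum_ge_iter_ln (a : nat) x k X : 0 <= x -> iter a (@ln R) x < 1 ->
  #|X|%:R <= x ^+ 2 -> 0 < k -> ratio_ge e k X ->
  1 / 2 * ln k - 8 * a%:R <= S.
Proof.
elim: a x k X => [|a IH] x k X x0 xlt Xx k0 rX.
  have : 1 <= #|X|%:R :> R by case: rX; rewrite -card_gt0 ler1n.
  by move: xlt => /= xlt; nra.
have S0 := odd_cycle_sum_ge0.
have [small|big] := leP (ln k) (16 * a.+1%:R); first by lra.
rewrite iterSr in xlt.
set n : R := #|X|%:R in Xx *.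
have n1 : 1 <= n by case: rX; rewrite -card_gt0 /n ler1n.
have n0 : 0 < n by lra.
have x_gt0 : 0 < x by nra.
have kn : ln k <= ln n by rewrite ler_ln ?posrE //; apply: ratio_le_card rX; apply: ltW.
have nx : ln n <= 2 * ln x.
  have : ln n <= ln (x ^+ 2) by rewrite ler_ln ?posrE // exprn_gt0.
  by rewrite lnXn //; lra.
rewrite -natr1 in big.
have a_ge0 : 0 <= a%:R :> R by [].
(* If [ln x < 1], then [ln k <= 2 ln x < 2], against [big]. From here on the index is [a + 2], hence
   [ln k > 32]. *)
case: a IH xlt big a_ge0 => [|a] IH xlt big a_ge0; first by move: xlt => /=; lra.
move: big a_ge0; rewrite -natr1 => big; rewrite -{1}natr1 => a_ge0.
have a0 : 0 <= a%:R :> R by [].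
have aE : a.+2%:R = a%:R + 2 :> R by rewrite -addn2 natrD.
have lk : 32 < ln k by lra.
have k_big : 2 ^+ 11 <= k.
  rewrite -[leRHS]lnK ?posrE //; apply: le_trans (@expR_ge_expn R (ln k) 10 _); last by lra.
  by apply: lerXn2r; rewrite ?nnegrE; lra.
pose rho := (Num.truncn (ln n)).+1; pose m := Num.truncn (k * ln n).
have rho_le : (Num.truncn (ln n))%:R <= ln n by rewrite truncn_le; lra.
have kln0 : 1 <= k * ln n by nra.
have m_le : m%:R <= k * ln n by rewrite truncn_le; lra.
have m_gt : k * ln n < m.+1%:R by apply: truncnS_gt.
have ln32 := ln_exp2 R 5.
have [all_small|/existsNP[Y /not_implyP[YX /not_implyP[Y0 /not_implyP[Ym /negP]]]]] :=
  pselect (forall Y : {set V}, Y \subset X -> Y != finset.set0 -> (#|Y| <= m)%N ->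
     8 * 4 * #|Y|%:R <= k * (alpha e Y)%:R).
  have cyc t : odd t -> (rho.*2 < t)%N -> (t <= m.*2)%N -> has_cycle e t.
    move=> t_odd rt tm.
    apply: (@odd_cycles_of_ratio V e e_sym e_irr R k 4 X rho m t) => //.
    - exact: ltW.
    - by lra.
    - by apply: le_trans (expR_le_exp4 _); [rewrite lnK ?posrE | lra].
    - by rewrite truncn_gt0.
  (* The factor [ln n] in [m] cancels the one in [rho], so only a constant is lost. *)
  have := odd_cycle_sum_interval cyc; apply: le_trans.
  have h1 : ln (k * ln n) <= ln (m.*2.+1%:R : R).
    rewrite ler_ln ?posrE ?ltr0Sn //; last by lra.
    by rewrite natr_doubleS; move: m_gt; rewrite -(natr1 m); lra.
  have h2 : ln (rho.*2.+1%:R : R) <= ln (2 ^+ 5 * ln n).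
    rewrite ler_ln ?posrE ?ltr0Sn //; last by rewrite mulr_gt0 ?exprn_gt0 //; lra.
    by rewrite natr_doubleS /rho -(natr1 (Num.truncn _)); lra.
  rewrite lnM ?posrE // in h1; last by lra.
  rewrite lnM ?posrE ?exprn_gt0 // in h2; last by lra.
  by rewrite aE; lra.
rewrite -ltNge => Yk.
have k'0 : 0 < k / 2 ^+ 5 by rewrite divr_gt0 ?exprn_gt0.
have rY : ratio_ge e (k / 2 ^+ 5) Y.
  by split=> //; rewrite mulrAC ler_pdivrMr ?exprn_gt0 //; lra.
have lnk' : ln k - 5 <= ln (k / 2 ^+ 5).
  by rewrite ln_div ?posrE ?exprn_gt0 //; lra.
have Yle : #|Y|%:R <= 2 * k * ln x.
  have : #|Y|%:R <= m%:R :> R by rewrite ler_nat.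
  by nra.
(* Either [|Y| <= (ln x)^2] and the induction hypothesis applies, or [|Y| <= 4 k^2], which is at
   most [(k / 32)^4] because [k >= 2^11]. *)
have [kx|xk] := leP (2 * k) (ln x).
  suff : 1 / 2 * ln (k / 2 ^+ 5) - 8 * a.+1%:R <= S by rewrite aE -(natr1 a); lra.
  apply: IH xlt _ k'0 rY; first by lra.
  by apply: le_trans Yle _; rewrite expr2 ler_pM2r //; lra.
have : 1 / 2 * (ln (k / 2 ^+ 5) - 10) <= S.
  apply: sum_ge_poly_ratio rY _ => //; first by lra.
  apply: le_trans Yle _; apply: le_trans (_ : 4 * k ^+ 2 <= _); first by nra.
  rewrite expr_div_n ler_pdivlMr ?exprn_gt0 //.
  have -> : 4 * k ^+ 2 * (2 ^+ 5) ^+ 4 = (2 ^+ 11 * k) ^+ 2.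
    have -> : 4 = 2 ^+ 2 :> R by rewrite -natrX.
    by rewrite [RHS]exprMn -!exprM mulrAC -exprD.
  have k2 : 2 ^+ 11 * k <= k ^+ 2 by rewrite [leRHS]expr2 ler_pM2r.
  rewrite (exprM k 2 2); apply: lerXn2r k2; rewrite nnegrE ltW ?exprn_gt0 //.
  by rewrite mulr_gt0 ?exprn_gt0.
by rewrite aE; lra.
Qed.
End Main.

Theorem theorem5 (R : realType) (n : nat) (G : finType) (edge : rel G)
    (graphG : simple_graph edge) (cardG : #|G| = n) :
  odd_cycle_sum R edge >=
    1 / 2 * ln (hall_ratio R edge) - 8 * (log_star R n)%:R.
Proof.
case: graphG => e_sym e_irr.
set S := odd_cycle_sum R edge; set L := (log_star R n)%:R.
have S0 : 0 <= S := odd_cycle_sum_ge0 R edge.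
have L0 : 0 <= L :> R by [].
(* [ln] is 0 here by default; this case includes the graph without vertices. *)
have [h0|h0] := leP (hall_ratio R edge) 0; first by rewrite ln0 //; lra.
(* A uniform bound on the ratios passes to the supremum, which need not be shown to be attained. The
   iteration starts at [x = n], where [|X| <= n <= n^2]. *)
have bound (X : {set G}) : X != finset.set0 ->
    #|X|%:R / (alpha edge X)%:R <= expR (2 * S + 16 * L).
  move=> X0.
  have a0 : 0 < (alpha edge X)%:R :> R by rewrite ltr0n alpha_gt0.
  have r0 : 0 < #|X|%:R / (alpha edge X)%:R :> R.
    by rewrite divr_gt0 // ltr0n card_gt0.
  rewrite -[leLHS]lnK ?posrE // ler_expR.
  have := @sum_ge_iter_ln R G edge e_sym e_irr (log_star R n) n%:R _ X _ _ _ r0.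
  rewrite -/S -/L => H.
  suff : 1 / 2 * ln (#|X|%:R / (alpha edge X)%:R) - 8 * L <= S by lra.
  apply: H => //.
  - by rewrite /log_star; case: ex_minnP.
  - rewrite -natrX ler_nat -cardG; apply: leq_trans (max_card _) _.
    by rewrite expnS expn1; case: #|G| => // c; rewrite leq_pmulr.
  - by split=> //; rewrite divfK // gt_eqF.
suff : ln (hall_ratio R edge) <= 2 * S + 16 * L by lra.
rewrite -[leRHS]expRK ler_ln ?posrE ?expR_gt0 //.
apply: ge_sup; last by move=> _ [X X0 ->]; apply: bound.
apply/set0P; apply/negP => /eqP E; move: h0.
by rewrite /hall_ratio E sup0 ltxx.
Qed.
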